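(* Let $\mathcal{X},\mathcal{Y},\mathcal{Z},\tilde{\mathcal{Z}},\mathfrak{Z}$ be finite dimensional real Hilbert spaces, $\mathbf{C}\subset\mathfrak{Z}$ a nonempty closed convex set, $\Psi\in\Gamma_0(\mathcal{Z})$ coercive with $\operatorname{dom}\Psi=\mathcal{Z}$, and let $A\in\mathcal{B}(\mathcal{X},\mathcal{Y})$, $B\in\mathcal{B}(\mathcal{Z},\tilde{\mathcal{Z}})$, $\mathfrak{L}\in\mathcal{B}(\mathcal{X},\mathcal{Z})$, $\mathfrak{C}\in\mathcal{B}(\mathcal{X},\mathfrak{Z})$, $\mu\in\mathbb{R}_{++}$ with $\mathbf{C}\cap\operatorname{ran}\mathfrak{C}\neq\emptyset$. With $\mathbf{\Psi}_{B_c}$ and $\mathfrak{L}_c$ as defined in the context, consider the three conditions $(C_1)$ $A^*A-\mu\mathfrak{L}^*B^*B\mathfrak{L}\succeq\mathrm{O}_{\mathcal{X}}$; $(C_2)$ $J_{\mathbf{\Psi}_{B_c}\circ\mathfrak{L}_c}:=\frac12\|y-A\cdot\|_{\mathcal{Y}}^2+\mu\,\mathbf{\Psi}_{B_c}\circ\mathfrak{L}_c\in\Gamma_0(\mathcal{X})$ for any $y\in\mathcal{Y}$; $(C_3)$ $J^{(0)}_{\mathbf{\Psi}_{B_c}\circ\mathfrak{L}_c}:=\frac12\|A\cdot\|_{\mathcal{Y}}^2+\mu\,\mathbf{\Psi}_{B_c}\circ\mathfrak{L}_c\in\Gamma_0(\mathcal{X})$. Then $(C_1)\implies(C_2)\i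ff(C_3)$.
   Context: $\mathbb{R}_{++}$ is the set of positive reals; $\mathcal{B}(\mathcal{H},\mathcal{K})$ is the set of linear operators $\mathcal{H}\to\mathcal{K}$; $L^*$ is the adjoint; $\operatorname{ran}$ the range; $\succeq\mathrm{O}_{\mathcal{X}}$ means positive semidefinite. $\Gamma_0(\mathcal{H})$ is the set of proper lower semicontinuous convex functions $\mathcal{H}\to(-\infty,\infty]$; $\operatorname{dom}\Psi:=\{z\mid\Psi(z)<\infty\}$; coercive means $\Psi(z)\to\infty$ as $\|z\|\to\infty$. $\iota_{\mathbf{C}}$ is the indicator function of $\mathbf{C}$ ($0$ on $\mathbf{C}$, $\infty$ elsewhere). Product spaces carry the sum inner product. Define $\mathcal{Z}_c:=\mathcal{Z}\times\mathfrak{Z}$, $\tilde{\mathcal{Z}}_c:=\tilde{\mathcal{Z}}\times\mathfrak{Z}$, $\mathfrak{L}_c:\mathcal{X}\to\mathcal{Z}_c:x\mapsto(\mathfrak{L}x,\mathfrak{C}x)$, $B_c:\mathcal{Z}_c\to\tilde{\mathcal{Z}}_c:(z_1,z_2)\mapsto(Bz_1,0_{\mathfrak{Z}})$, $\mathbf{\Psi}:\mathcal{Z}_c\to(-\infty,\infty]:(z_1,z_2)\mapsto\Psi(z_1)+\iota_{\mathbf{C}}(z_2)$, and $$\mathbf{\Psi}_{B_c}(\cdot):=\mathbf{\Psi}(\cdot)-\min_{v\in\mathcal{Z}_c}\Big[\mathbf{\Psi}(v)+\tfrac12\|B_c(\cdot-v)\|_{\tilde{\mathcal{Z}}_c}^2\Big].$$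 *)

(* Defs.v *)
From HB Require Import structures.
From mathcomp Require Import all_boot all_order all_algebra.
From mathcomp Require Import all_classical all_reals all_analysis.
From mathcomp Require Import ring lra.

Set Implicit Arguments.
Unset Strict Implicit.
Unset Printing Implicit Defensive.

Import Order.TTheory GRing.Theory Num.Theory.
Import numFieldNormedType.Exports.

Local Open Scope classical_set_scope.
Local Open Scope ring_scope.

(* Finite dimensional real Hilbert spaces. Completeness needs no axiom, since  *)
(* the dimension is finite. The norm and topology are those of the library's   *)
(* normed modules, tied to the inner product by inner_norm.                    *)
HB.mixin Record NormedVector_isHilbert (R : realType) V
    & NormedModule R V & Vector R V := {
  inner : V -> V -> R ;
  innerC : forall u v, inner u v = inner v u ;
  innerP : forall a u v w, inner (a *: u + v) w = a * inner u w + inner v w ;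
  inner_norm : forall u, inner u u = `|u| ^+ 2
}.

#[short(type="finHilbertType")]
HB.structure Definition FinHilbert (R : realType) :=
  {V of NormedModule R V & Vector R V & NormedVector_isHilbert R V}.

HB.factory Record Vector_isHilbert (R : realType) V & Vector R V := {
  inner : V -> V -> R ;
  innerC : forall u v, inner u v = inner v u ;
  innerP : forall a u v w, inner (a *: u + v) w = a * inner u w + inner v w ;
  inner_gt0 : forall u, u != 0 -> 0 < inner u u
}.

HB.builders Context (R : realType) V & Vector_isHilbert R V.

Let inner0l w : inner 0 w = 0.
Proof. by have := innerP (-1) 0 0 w; rewrite scaler0 addr0 mulN1r addNr. Qed.

Let innerDl u v w : inner (u + v) w = inner u w + inner v w.
Proof. by have := innerP 1 u v w; rewrite scale1r mul1r. Qed.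

Let innerZl a u w : inner (a *: u) w = a * inner u w.
Proof. by have := innerP a u 0 w; rewrite addr0 inner0l addr0. Qed.

Let innerDr u v w : inner u (v + w) = inner u v + inner u w.
Proof. by rewrite innerC innerDl !(innerC u). Qed.

Let innerZr a u w : inner u (a *: w) = a * inner u w.
Proof. by rewrite innerC innerZl (innerC u). Qed.

Let inner_ge0 u : 0 <= inner u u.
Proof. by have [->|/inner_gt0/ltW//] := eqVneq u 0; rewrite inner0l. Qed.

Let hnorm u := Num.sqrt (inner u u).

Let hnormD u v : hnorm (u + v) <= hnorm u + hnorm v.
Proof.
have hu : 0 <= hnorm u by exact: sqrtr_ge0.
have hv : 0 <= hnorm v by exact: sqrtr_ge0.
have su : hnorm u ^+ 2 = inner u u by rewrite sqr_sqrtr.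
have sv : hnorm v ^+ 2 = inner v v by rewrite sqr_sqrtr.
have E : forall a b, inner (a *: u + b *: v) (a *: u + b *: v) =
    a ^+ 2 * inner u u + 2 * (a * b) * inner u v + b ^+ 2 * inner v v.
  move=> a b; rewrite !(innerDl, innerDr, innerZl, innerZr) (innerC v u); ring.
have CS : inner u v <= hnorm u * hnorm v.
  have [v0|v0] := eqVneq v 0.
    by rewrite v0 innerC inner0l mulr_ge0// sqrtr_ge0.
  have ivp := inner_gt0 v0.
  have := inner_ge0 (inner v v *: u + (- inner u v) *: v); rewrite E => h.
  have {}h : 0 <= inner v v * (inner u u * inner v v - inner u v ^+ 2).
    by apply: le_trans h _; rewrite le_eqVlt; apply/orP; left; apply/eqP; ring.
  have {}h : inner u v ^+ 2 <= (hnorm u * hnorm v) ^+ 2.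
    by rewrite exprMn su sv -subr_ge0; rewrite pmulr_rge0 in h.
  apply: le_trans (ler_norm _) _.
  by rewrite -(@ler_pXn2r _ 2) ?nnegrE ?mulr_ge0// real_normK// num_real.
rewrite -(@ler_pXn2r _ 2) ?nnegrE ?addr_ge0 ?sqrtr_ge0//.
rewrite [leLHS]sqr_sqrtr//.
have := E 1 1; rewrite !scale1r => ->.
rewrite sqrrD su sv mulr2n; lra.
Qed.

Let hnormZ a u : hnorm (a *: u) = `|a| * hnorm u.
Proof.
by rewrite /hnorm innerZl innerZr mulrA -expr2 sqrtrM ?sqr_ge0// sqrtr_sqr.
Qed.

Let hnorm_eq0 u : hnorm u = 0 -> u = 0.
Proof.
move=> /eqP; rewrite sqrtr_eq0 => h; apply/eqP; apply: contraT => /inner_gt0.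
by rewrite ltNge h.
Qed.

HB.instance Definition _ :=
  Lmodule_isNormed.Build R V hnormD hnormZ hnorm_eq0.

Let inner_hnorm u : inner u u = `|u| ^+ 2.
Proof. by rewrite [`|u|]/(hnorm u) sqr_sqrtr. Qed.

HB.instance Definition _ :=
  NormedVector_isHilbert.Build R V innerC innerP inner_hnorm.

HB.end.

(* The Hilbert product. An alias is needed because the library's normed module *)
(* structure on U * V carries the max norm.                                    *)
Definition hprod (R : realType) (U V : finHilbertType R) : Type := (U * V)%type.

Section hprod.
Context (R : realType) (U V : finHilbertType R).

HB.instance Definition _ := Vector.copy (hprod U V) (U * V)%type.

Let hinner (p q : hprod U V) : R := inner p.1 q.1 + inner p.2 q.2.

Let hinnerC p q : hinner p q = hinner q p.
Proof. by rewrite /hinner innerC (innerC p.2). Qed.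

Let hinnerP a p q r : hinner (a *: p + q) r = a * hinner p r + hinner q r.
Proof. by rewrite /hinner /= !innerP; ring. Qed.

Let hinner_gt0 p : p != 0 -> 0 < hinner p p.
Proof.
move=> p0; rewrite /hinner !inner_norm lt_neqAle addr_ge0 ?sqr_ge0// andbT.
apply: contra p0; rewrite eq_sym paddr_eq0 ?sqr_ge0// !sqrf_eq0 !normr_eq0.
by case: p => p1 p2 /= /andP[/eqP-> /eqP->].
Qed.

HB.instance Definition _ :=
  Vector_isHilbert.Build R (hprod U V) hinnerC hinnerP hinner_gt0.

End hprod.

Section operators.
Context (R : realType) (H K : finHilbertType R).

Definition adjoint (L : 'Hom(H, K)) : 'Hom(K, H) :=
  xget 0 [set M : 'Hom(K, H) | forall x y, inner (L x) y = inner x (M y)].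

Let innerlin (E : finHilbertType R) (w : E) :
  exists f : {linear E -> R^o}, forall u, f u = inner u w.
Proof.
have lf : linear (fun u : E => inner u w : R^o) by move=> a u v; exact: innerP.
pose m := GRing.isLinear.Build R E R^o *:%R (fun u => inner u w : R^o) lf.
pose f : {linear E -> R^o} := HB.pack (fun u : E => inner u w : R^o) m.
by exists f.
Qed.

Let inner_suml (E : finHilbertType R) n (c : 'I_n -> R) (b : 'I_n -> E) w :
  inner (\sum_i c i *: b i) w = \sum_i c i * inner (b i) w.
Proof.
have [f fE] := innerlin w; rewrite -fE linear_sum; apply: eq_bigr => i _.
by rewrite linearZ fE.
Qed.

Let adjoint_ex (L : 'Hom(H, K)) :
  exists M : 'Hom(K, H), forall x y, inner (L x) y = inner x (M y).
Proof.
pose n := \dim {: H}; pose b i := (vbasis {: H})`_i.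
pose rowf (E : finHilbertType R) (c : 'I_n -> E) (w : E) : 'rV[R]_n :=
  \row_i inner (c i) w.
have rowE (E : finHilbertType R) (c : 'I_n -> E) : exists g : 'Hom(E, 'rV[R]_n), forall w, g w = @rowf E c w.
  have lf : linear (@rowf E c).
    move=> a u v; apply/rowP => i; rewrite !mxE.
    by rewrite innerC innerP !(innerC _ (c i)).
  pose m := GRing.isLinear.Build R E 'rV[R]_n *:%R (@rowf E c) lf.
  pose f : {linear E -> 'rV[R]_n} := HB.pack (@rowf E c) m.
  by exists (linfun f) => w; rewrite lfunE.
have [p pE] := rowE H (fun i => b i).
have [g gE] := rowE K (fun i => L (b i)).
have xE x : x = \sum_(i < n) coord (vbasis {: H}) i x *: b i.
  exact: coord_vbasis (memvf x).
have pker : lker p == 0%VS.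
  rewrite -subv0; apply/subvP => w; rewrite memv_ker pE => /eqP w0.
  have /eqP : inner w w = 0.
    rewrite [X in inner X _]xE inner_suml big1// => i _.
    by have /rowP/(_ i) := w0; rewrite !mxE => ->; rewrite mulr0.
  by rewrite inner_norm sqrf_eq0 normr_eq0 memv0.
have pfull : limg p = fullv.
  apply/eqP; rewrite eqEdim subvf /=.
  have := limg_ker_dim p fullv; rewrite (eqP pker) capv0 dimv0 add0n => ->.
  by rewrite dimvf /dim /= mul1n.
exists (p^-1 \o g)%VF => x y; rewrite comp_lfunE.
have /rowP pg : p (p^-1%VF (g y)) = g y.
  by apply: limg_lfunVK; rewrite pfull memvf.
rewrite [in LHS](xE x) [in RHS](xE x) linear_sum.
under eq_bigr do rewrite linearZ /=.
rewrite !inner_suml; apply: eq_bigr => i _; congr (_ * _).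
by have := pg i; rewrite pE gE !mxE => ->.
Qed.

Lemma adjointP (L : 'Hom(H, K)) x y : inner (L x) y = inner x (adjoint L y).
Proof.
have [M ML] := adjoint_ex L.
by have := @xgetI _ 0 [set M : 'Hom(K, H) | _] M ML; apply.
Qed.

Definition psd (T : 'End(H)) :=
  (forall x y, inner (T x) y = inner x (T y)) /\ forall x, 0 <= inner (T x) x.

End operators.

Section functions.
Local Open Scope ereal_scope.

Definition edom (T : Type) (R : realType) (f : T -> \bar R) : set T :=
  [set x | f x < +oo].

Definition proper (T : Type) (R : realType) (f : T -> \bar R) : Prop :=
  (forall x, f x != -oo) /\ edom f !=set0.

Definition econvex (R : realType) (H : lmodType R) (f : H -> \bar R) : Prop :=
  forall (x y : H) (t : R), (0 < t < 1)%R ->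
    f (t *: x + (1 - t) *: y)%R <= t%:E * f x + (1 - t)%:E * f y.

Definition Gamma0 (R : realType) (H : finHilbertType R) : set (H -> \bar R) :=
  [set f | [/\ proper f, lower_semicontinuous f & econvex f]].

Definition coercive (R : realType) (H : finHilbertType R) (f : H -> \bar R) :=
  forall M : R, \forall r \near +oo%R, forall z : H, (r <= `|z|)%R -> M%:E <= f z.

Definition eindicator (T : Type) (R : realType) (C : set T) (x : T) : \bar R :=
  if x \in C then 0 else +oo.

(* A genuine minimum: when it is not attained, emin f is a junk value rather   *)
(* than the infimum.                                                           *)
Definition emin (T : Type) (R : realType) (f : T -> \bar R) : \bar R :=
  xget +oo (range f `&` lbound (range f)).

Definition enhanced (R : realType) (H K : finHilbertType R)
    (f : H -> \bar R) (B : H -> K) (z : H) : \bar R :=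
  f z - emin (fun v => f v + (2^-1 * `|B (z - v)| ^+ 2)%:E).

End functions.

Section constrained.
Context (R : realType) (X Z Zt Zf : finHilbertType R).

Definition Lc (L : 'Hom(X, Z)) (D : 'Hom(X, Zf)) (x : X) : hprod Z Zf :=
  (L x, D x).

Definition Bc (B : 'Hom(Z, Zt)) (z : hprod Z Zf) : hprod Zt Zf := (B z.1, 0).

Definition Psic (Psi : Z -> \bar R) (C : set Zf) (z : hprod Z Zf) : \bar R :=
  (Psi z.1 + eindicator R C z.2)%E.

End constrained.

(* Main.v *)
Require Import Defs.
From HB Require Import structures.
From mathcomp Require Import all_boot all_order all_algebra.
From mathcomp Require Import all_classical all_reals all_analysis.
From mathcomp Require Import finmap ring lra.
Import Order.TTheory GRing.Theory Num.Theory.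
Import numFieldNormedType.Exports.
Set Implicit Arguments.
Unset Strict Implicit.
Local Open Scope classical_set_scope.
Local Open Scope ring_scope.

(** Write [psi] for the finite function behind [Psi] and
    [m z = min_v (psi v + 1/2 |B (z - v)|^2)] for its partial envelope. The
    second component of [Bc B] vanishes, so the constraint factors out of the
    minimum: on the product space the enhanced function is
    [(psi - m) z.1 + indicator C z.2]. The minimum has to be attained, because
    the [emin] of an unattained infimum carries no information; this is where
    coercivity enters, through compactness of the balls and lower
    semicontinuity ([lsc_coercive_min]).

    The function [- m] is not convex, but it is a supremum of the quadratics
    [z |-> - psi v - 1/2 |B (z - v)|^2], all with the same curvature, so along
    a segment its convexity defect at parameter [t] is at most
    [1/2 t (1 - t) |B (x - y)|^2] ([opp_envelope_weakly_convex]). The fidelity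
    term [1/2 |A x|^2] has a surplus of convexity of exactly
    [1/2 t (1 - t) |A (x - y)|^2]. Condition [C1] says
    [mu |B (L x)|^2 <= |A x|^2] for all [x], so the surplus pays for [mu] times
    the defect along [L], and the objective for [y = 0] is a finite convex
    lower semicontinuous function plus the indicator of the closed convex
    nonempty set [D @^-1` C] ([Gamma0_enhanced]).

    Finally, the objectives for [y] and for [0] differ by the continuous affine
    function [1/2 |y|^2 - <y, A x>], and adding such a function preserves
    [Gamma0] ([Gamma0_tilt]); hence [C2] and [C3] are equivalent, and [C1] only
    has to be shown to imply [C3]. *)

(** * Inner products *)

Section inner_theory.
Context {R : realType} {H : finHilbertType R}.
Implicit Types u v w x y : H.

Lemma inner0l w : inner 0 w = 0.
Proof. by have := innerP (-1) 0 0 w; rewrite scaler0 addr0 mulN1r addNr. Qed.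

Lemma innerDl u v w : inner (u + v) w = inner u w + inner v w.
Proof. by have := innerP 1 u v w; rewrite scale1r mul1r. Qed.

Lemma innerZl a u w : inner (a *: u) w = a * inner u w.
Proof. by have := innerP a u 0 w; rewrite addr0 inner0l addr0. Qed.

Lemma innerDr u v w : inner u (v + w) = inner u v + inner u w.
Proof. by rewrite innerC innerDl !(innerC u). Qed.

Lemma innerZr a u w : inner u (a *: w) = a * inner u w.
Proof. by rewrite innerC innerZl (innerC u). Qed.

Lemma sqr_normD u v :
  `|u + v| ^+ 2 = `|u| ^+ 2 + 2 * inner u v + `|v| ^+ 2.
Proof. by rewrite -!inner_norm !(innerDl, innerDr) (innerC v u); ring. Qed.

Lemma sqr_normB u v :
  `|u - v| ^+ 2 = `|u| ^+ 2 - 2 * inner u v + `|v| ^+ 2.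
Proof. by rewrite sqr_normD normrN -scaleN1r innerZr; ring. Qed.

(** Cauchy-Schwarz, read off from the triangle inequality that the norm of a
    normed module already satisfies. *)
Lemma inner_le_norm u v : inner u v <= `|u| * `|v|.
Proof.
have : `|u + v| ^+ 2 <= (`|u| + `|v|) ^+ 2.
  by rewrite lerXn2r ?nnegrE ?addr_ge0// ler_normD.
by rewrite sqr_normD; nra.
Qed.

Lemma normr_inner_le u v : `|inner u v| <= `|u| * `|v|.
Proof.
rewrite ler_norml inner_le_norm andbT lerNl -mulN1r -innerZl scaleN1r.
by rewrite -[X in _ <= X * _]normrN inner_le_norm.
Qed.

(** The squared norm is convex with an exact surplus; it measures the
    curvature both of the fidelity term and of the penalty in the envelope. *)
Lemma sqr_norm_convex_comb t x y :
  `|t *: x + (1 - t) *: y| ^+ 2 =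
  t * `|x| ^+ 2 + (1 - t) * `|y| ^+ 2 - t * (1 - t) * `|x - y| ^+ 2.
Proof.
by rewrite sqr_normB sqr_normD !normrZ !exprMn !real_normK ?num_real//
   innerZl innerZr; ring.
Qed.

Lemma continuous_sqr_norm : continuous (fun w : H => `|w| ^+ 2 : R).
Proof.
by move=> w; apply: cvgM; exact: norm_continuous.
Qed.

Lemma continuous_inner v : continuous (fun w : H => inner w v : R).
Proof.
(* Polarization reduces the claim to continuity of the norm. *)
have -> : (fun w : H => inner w v) =
    (fun w => 2^-1 * (`|w + v| ^+ 2 - `|w| ^+ 2 - `|v| ^+ 2)).
  by apply/funext => w; rewrite sqr_normD; field.
move=> w; apply: cvgM; first exact: cvg_cst.
apply: cvgB; last exact: cvg_cst.
apply: cvgB; last exact: continuous_sqr_norm.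
apply: (@cvg_comp _ _ _ (fun w : H => w + v) (fun w : H => `|w| ^+ 2)
  _ (nbhs (w + v))).
  by apply: cvgD; [exact: cvg_id | exact: cvg_cst].
exact: continuous_sqr_norm.
Qed.

(** Coordinates in a basis are inner products with fixed vectors. Since inner
    products are continuous and bounded, this replaces the equivalence of norms
    in finite dimension. *)
Lemma dual_basis :
  exists u : 'I_(\dim {:H}) -> H,
    forall w, w = \sum_i inner w (u i) *: (vbasis {:H})`_i.
Proof.
pose b (i : 'I_(\dim {:H})) := (vbasis {:H})`_i.
suff /choice[u uE] : forall i, exists ui, forall w,
    coord (vbasis {:H}) i w = inner w ui.
  exists u => w; rewrite {1}(coord_vbasis (memvf w)).
  by apply: eq_bigr => i _; rewrite uE.
move=> i.
(* The rank-one map f w = (coord i w) b_i satisfies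
   <f w, b_i> = (coord i w) |b_i|^2, so f^* b_i represents coord i up to
   the factor |b_i|^2. *)
have f_lin : linear (fun w : H => coord (vbasis {:H}) i w *: b i).
  by move=> a x y; rewrite linearP scalerDl scalerA.
pose m := GRing.isLinear.Build R H H *:%R _ f_lin.
pose f : {linear H -> H} := HB.pack (fun w : H => _) m.
have b_neq0 : b i != 0.
  have /free_not0-> // := basis_free (vbasisP {:H}).
  by rewrite mem_nth// size_tuple.
exists ((`|b i| ^+ 2)^-1 *: adjoint (linfun f) (b i)) => w.
rewrite innerZr -adjointP lfunE /= innerZl inner_norm mulrC mulfK//.
by rewrite sqrf_eq0 normr_eq0.
Qed.

Lemma adjointPl {K : finHilbertType R} (T : 'Hom(H, K)) x (y : K) :
  inner (adjoint T y) x = inner y (T x).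
Proof. by rewrite innerC -adjointP innerC. Qed.

End inner_theory.

(** * Topology of finite dimensional Hilbert spaces *)

Lemma continuous_lfun (R : realType) (H K : finHilbertType R) (T : 'Hom(H, K)) :
  continuous T.
Proof.
have [u uE] := @dual_basis R H.
have -> : (T : H -> K) =
    (fun w => \sum_i inner w (u i) *: T (vbasis {:H})`_i).
  apply/funext => w; rewrite {1}(uE w) linear_sum.
  by apply: eq_bigr => i _; rewrite linearZ.
apply: continuous_big => [|i _ w]; [exact: add_continuous|].
by apply: cvgZr_tmp; exact: continuous_inner.
Qed.

Lemma continuous_half_sqr_norm_lfun (R : realType) (H K : finHilbertType R)
    (T : 'Hom(H, K)) (a : H) :
  continuous (fun z => 2^-1 * `|T (z + a)| ^+ 2 : R).
Proof.
move=> z; apply: cvgM; first exact: cvg_cst.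
apply: (@cvg_comp _ _ _ (fun z => T (z + a)) (fun w : K => `|w| ^+ 2)
  _ (nbhs (T (z + a)))); last exact: continuous_sqr_norm.
apply: (@cvg_comp _ _ _ (fun z => z + a) T _ (nbhs (z + a))).
  by apply: cvgD; [exact: cvg_id | exact: cvg_cst].
exact: continuous_lfun.
Qed.

(** The ball is a closed subset of the image of a coordinate cube under the
    continuous map that recombines coordinates. *)
Lemma closed_ball_norm_compact (R : realType) (H : finHilbertType R) (r : R) :
  compact [set w : H | `|w| <= r].
Proof.
have [u uE] := @dual_basis R H.
pose n := \dim {:H}.
pose phi (c : 'rV[R]_n) : H := \sum_i c ord0 i *: (vbasis {:H})`_i.
pose M := \sum_i `|r| * `|u i|.
have phi_cont : continuous phi.
  apply: continuous_big => [|i _ c]; first exact: add_continuous.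
  have ci : continuous (fun c : 'rV[R]_n => c ord0 i).
    exact: coord_continuous.
  exact: cvgZr_tmp (ci c).
have cube_compact :
    compact [set c : 'rV[R]_n | forall i, `[- M, M]%classic (c ord0 i)].
  apply: (@rV_compact _ _ (fun=> `[- M, M]%classic)).
  by move=> _; apply: segment_compact.
have := continuous_compact (continuous_subspaceT phi_cont) cube_compact.
move=> /(subclosed_compact _); apply.
  apply: (@preimage_closed _ _ (fun w : H => `|w|) [set x | x <= r]).
    by move=> w _; exact: norm_continuous.
  exact: closed_le.
move=> w /= wr; exists (\row_i inner w (u i)).
  move=> i; rewrite /= in_itv /= mxE -ler_norml.
  apply: (le_trans (normr_inner_le _ _)).
  rewrite /M (bigD1 i)//=; apply: ler_wpDr.
    by apply: sumr_ge0 => j _; rewrite mulr_ge0.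
  by rewrite ler_wpM2r// (le_trans wr)// ler_norm.
by rewrite [RHS]uE /phi; apply: eq_bigr => i _; rewrite mxE.
Qed.

(** If no point of [K] were a minimizer, the open sets [f > a] for values [a]
    taken by [f] on [K] would cover [K]; but the point where the least [a] of a
    finite subcover is taken lies in none of them. *)
Lemma compact_lsc_min (T : ptopologicalType) (R : realType) (K : set T)
    (f : T -> R) :
  K !=set0 -> compact K -> lower_semicontinuous (EFin \o f) ->
  exists2 x, K x & forall y, K y -> f x <= f y.
Proof.
move=> [x0 Kx0] cptK /lower_semicontinuousP f_lsc; apply: contrapT => nomin.
have below x : K x -> exists2 y, K y & f y < f x.
  move=> Kx; apply: contrapT => noy; apply: nomin; exists x => // y Ky.
  by rewrite leNgt; apply/negP => fyx; apply: noy; exists y.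
have : cover_compact K by rewrite -compact_cover.
case/(_ _ (f @` K) (fun a => [set x | a < f x])) => [a _|x Kx|s sK Kcover].
- have := f_lsc a; congr open; apply/funext => x /=; by rewrite lte_fin.
- by have [y Ky fyx] := below _ Kx; exists (f y) => //; exists y.
have [a0 sa0 _] := Kcover _ Kx0.
have [m _ mmin] := @arg_minP _ _ s [` sa0]%fset xpredT (fun a => val a) isT.
have /set_mem[y Ky fym] := sK _ (valP m).
have [a sa] := Kcover _ Ky.
by rewrite /= fym ltNge (mmin [` sa]%fset isT).
Qed.

(** Outside a large ball [f] exceeds [f 0], so a minimizer over that ball is a
    global one. *)
Lemma lsc_coercive_min (R : realType) (H : finHilbertType R) (f : H -> R) :
  lower_semicontinuous (EFin \o f) -> coercive (EFin \o f) ->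
  exists x, forall y, f x <= f y.
Proof.
move=> f_lsc /(_ (f 0)) [r0 [_ f_ge]].
pose r := Num.max 0 (r0 + 1).
have [|x _ xmin] := compact_lsc_min _ (@closed_ball_norm_compact _ H r) f_lsc.
  by exists 0; rewrite /= normr0 le_max lexx.
exists x => y; have [yr|/ltW ry] := leP `|y| r; first exact: xmin.
apply: (@le_trans _ _ (f 0)).
  by apply: xmin; rewrite /= normr0 le_max lexx.
rewrite -lee_fin; apply: (f_ge r) => //.
by rewrite lt_max; apply/orP; right; rewrite ltrDl.
Qed.

(** * Lower semicontinuity *)

Section lower_semicontinuity.
Context {T : topologicalType} {R : realType}.
Local Open Scope ereal_scope.

Lemma lower_semicontinuousD (f g : T -> \bar R) :
  (forall x, f x != -oo) -> (forall x, g x != -oo) ->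
  lower_semicontinuous f -> lower_semicontinuous g ->
  lower_semicontinuous (f \+ g).
Proof.
move=> fNy gNy f_lsc g_lsc x a afg.
(* Split the level a into levels strictly below f x and g x. *)
suff [b [c [bf cg abc]]] : exists b c : R,
    [/\ b%:E < f x, c%:E < g x & (a <= b + c)%R].
  have [V Vx Vf] := f_lsc _ _ bf; have [W Wx Wg] := g_lsc _ _ cg.
  exists (V `&` W); first exact: filterI.
  move=> y [/Vf bfy /Wg cgy]; apply: (@le_lt_trans _ _ (b%:E + c%:E)).
    by rewrite -EFinD lee_fin.
  exact: lteD.
move: afg (fNy x) (gNy x) => /=; case: (f x) (g x) => [p| |] [q| |]//= afg _ _.
- rewrite -EFinD lte_fin in afg.
  exists (p - (p + q - a) / 2)%R, (q - (p + q - a) / 2)%R.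
  by rewrite !lte_fin; split; lra.
- exists (p - 1)%R, (a - (p - 1))%R; rewrite lte_fin ltry; split => //; lra.
- exists (a - (q - 1))%R, (q - 1)%R; rewrite lte_fin ltry; split => //; lra.
- exists a, 0%R; rewrite !ltry addr0; split => //.
Qed.

Lemma lower_semicontinuous_comp (S : topologicalType) (f : T -> \bar R)
    (g : S -> T) :
  continuous g -> lower_semicontinuous f -> lower_semicontinuous (f \o g).
Proof.
by move=> g_cont f_lsc x a /f_lsc[V Vgx Vf]; exists (g @^-1` V);
  [exact: g_cont | move=> y /Vf].
Qed.

Lemma lower_semicontinuousZ (mu : R) (f : T -> R) : (0 < mu)%R ->
  lower_semicontinuous (EFin \o f) ->
  lower_semicontinuous (EFin \o (fun x => mu * f x)%R).
Proof.
move=> mu0 f_lsc x a; rewrite /= lte_fin mulrC -ltr_pdivrMr// => afx.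
have [|V Vx Vf] := f_lsc x (a / mu)%R; first by rewrite lte_fin.
exists V => // y /Vf; by rewrite /= !lte_fin ltr_pdivrMr// mulrC.
Qed.

(** A supremum of continuous functions that is attained at every point; this is
    the form in which minus an envelope appears. *)
Lemma lower_semicontinuous_continuous_minorant (f : T -> R) :
  (forall x, exists g : T -> R,
    [/\ {for x, continuous g}, g x = f x & forall y, (g y <= f y)%R]) ->
  lower_semicontinuous (EFin \o f).
Proof.
move=> minor x a; rewrite /= lte_fin; have [g [gx <- gf]] := minor x => agx.
exists (g @^-1` [set y | (a < y)%R]).
  by apply: gx; exact: lt_nbhsr.
by move=> y /= agy; rewrite lte_fin (lt_le_trans agy).
Qed.

Lemma continuous_lower_semicontinuous (f : T -> R) :
  continuous f -> lower_semicontinuous (EFin \o f).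
Proof.
move=> f_cont; apply: lower_semicontinuous_continuous_minorant => x.
by exists f; split=> //; exact: f_cont.
Qed.

Lemma lower_semicontinuous_indicator (S : set T) :
  closed S -> lower_semicontinuous (eindicator R S).
Proof.
move=> S_closed x a; rewrite /eindicator; case: ifPn => [_ a0|/negP xS _].
  exists setT; first exact: filterT.
  by move=> y _; case: ifPn => // _; rewrite ltry.
exists (~` S).
  apply: open_nbhs_nbhs; split; [exact: closed_openC|].
  by move=> Sx; apply: xS; exact: mem_set.
by move=> y Sy; rewrite memNset// ltry.
Qed.

End lower_semicontinuity.

(** * Stability of Gamma0 *)

Section Gamma0_theory.
Context {R : realType} {H : finHilbertType R}.
Local Open Scope ereal_scope.

Lemma Gamma0D_fin (f : H -> \bar R) (g : H -> R) :
  Gamma0 f -> lower_semicontinuous (EFin \o g) -> econvex (EFin \o g) ->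
  Gamma0 (f \+ (EFin \o g)).
Proof.
move=> [[fNy [x0 fx0]] f_lsc f_cvx] g_lsc g_cvx; split.
- split=> [x|]; first by rewrite /= adde_eq_ninfty negb_or fNy.
  by exists x0; rewrite /edom /= lte_add_pinfty// ltry.
- exact: lower_semicontinuousD.
- move=> x y t t01; have /andP[t0 t1] := t01.
  apply: (le_trans (leeD (f_cvx x y t t01) (g_cvx x y t t01))).
  rewrite /= !muleDr// ?fin_num_adde_defl//.
  by rewrite addeACA.
Qed.

Lemma Gamma0_indicator (S : set H) : S !=set0 -> closed S ->
  (forall x y t, (0 < t < 1)%R -> S x -> S y -> S (t *: x + (1 - t) *: y)%R) ->
  Gamma0 (eindicator R S).
Proof.
move=> [x0 Sx0] S_closed S_cvx; split.
- split=> [x|]; first by rewrite /eindicator; case: ifP.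
  by exists x0; rewrite /edom /= /eindicator mem_set// ltry.
- exact: lower_semicontinuous_indicator.
- move=> x y t t01; have /andP[t0 t1] := t01.
  have t1' : (0 < 1 - t)%R by rewrite subr_gt0.
  rewrite /eindicator; case: (boolP (x \in S)) => [|_]; last first.
    rewrite gt0_muley ?lte_fin// addye ?leey//.
    by case: ifP => _; rewrite ?mule0// gt0_muley ?lte_fin.
  move=> /set_mem Sx; case: (boolP (y \in S)) => [|_]; last first.
    by rewrite gt0_muley ?lte_fin// mule0 addey ?leey.
  by move=> /set_mem Sy; rewrite mem_set ?mule0 ?adde0//; exact: S_cvx.
Qed.

End Gamma0_theory.

(** * The partial envelope and the enhanced function *)

Lemma emin_attained (R : realType) (T : Type) (f : T -> \bar R) (v : T) :
  (forall w, f v <= f w)%E -> emin f = f v.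
Proof.
move=> fv; rewrite /emin; apply: xget_unique => [|_ [[w _ <-] fw]].
  by split; [exists v | move=> _ [w _ <-]; exact: fv].
by apply/eqP; rewrite eq_le fv fw//; exists v.
Qed.

Section partial_envelope.
Context {R : realType} {Z Zt : finHilbertType R}.
Variables (psi : Z -> R) (B : 'Hom(Z, Zt)).
Hypothesis psi_lsc : lower_semicontinuous (EFin \o psi).
Hypothesis psi_coercive : coercive (EFin \o psi).

Definition envelope_obj (z v : Z) : R := psi v + 2^-1 * `|B (z - v)| ^+ 2.

Lemma envelope_attained :
  exists p : Z -> Z, forall z v, envelope_obj z (p z) <= envelope_obj z v.
Proof.
suff /choice[p pP] : forall z, exists pz,
    forall v, envelope_obj z pz <= envelope_obj z v by exists p.
move=> z; apply: lsc_coercive_min.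
  have -> : EFin \o envelope_obj z =
      (EFin \o psi) \+ (EFin \o (fun v => 2^-1 * `|B (v - z)| ^+ 2)).
    apply/funext => v; rewrite /envelope_obj /= EFinD.
    by rewrite -opprB linearN normrN.
  apply: lower_semicontinuousD => //.
  apply: continuous_lower_semicontinuous.
  exact: continuous_half_sqr_norm_lfun.
move=> M; apply: filterS (psi_coercive M) => r psi_ge v rv.
apply: (le_trans (psi_ge v rv)); rewrite lee_fin lerDl.
by rewrite mulr_ge0// sqr_ge0.
Qed.

(* A selection of minimizers: m z is envelope_obj z (p z). *)
Variable p : Z -> Z.
Hypothesis pP : forall z v, envelope_obj z (p z) <= envelope_obj z v.

(** Freezing the minimizer at [p z0] gives a continuous minorant of [- m] that
    touches it at [z0]. *)
Lemma opp_envelope_lsc :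
  lower_semicontinuous (EFin \o (fun z => - envelope_obj z (p z))).
Proof.
apply: lower_semicontinuous_continuous_minorant => z0.
exists (fun z => - envelope_obj z (p z0)); split=> // [|z]; last first.
  by rewrite lerN2 pP.
apply: cvgN; apply: cvgD; first exact: cvg_cst.
exact: continuous_half_sqr_norm_lfun.
Qed.

(** The minimizer [v] for the point inside the segment is a competitor at both
    end points, and [|B (z - v)|^2] as a function of [z] has the exact
    convexity surplus of a squared norm. *)
Lemma opp_envelope_weakly_convex (x y : Z) (t : R) : 0 < t < 1 ->
  - envelope_obj (t *: x + (1 - t) *: y) (p (t *: x + (1 - t) *: y)) <=
  t * - envelope_obj x (p x) + (1 - t) * - envelope_obj y (p y)
    + 2^-1 * (t * (1 - t)) * `|B (x - y)| ^+ 2.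
Proof.
move=> /andP[t0 t1]; set z := t *: x + (1 - t) *: y; set v := p z.
have Bzv : B (z - v) = t *: B (x - v) + (1 - t) *: B (y - v).
  rewrite -!linearZ -linearD; congr (B _).
  rewrite /z !scalerBr addrACA -opprD -scalerDl (addrC t) subrK.
  by rewrite scale1r.
have Bxy : B (x - y) = B (x - v) - B (y - v).
  by rewrite -linearB opprB addrA subrK.
have := pP x v; have := pP y v.
rewrite {2 4 5}/envelope_obj Bzv Bxy sqr_norm_convex_comb.
set Ex := envelope_obj x (p x); set Ey := envelope_obj y (p y) => hy hx.
have hx' := ler_wpM2l (ltW t0) hx.
have hy' : (1 - t) * Ey <= (1 - t) * (psi v + 2^-1 * `|B (y - v)| ^+ 2).
  by apply: ler_wpM2l => //; rewrite subr_ge0 ltW.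
lra.
Qed.

(** The penalty under the minimum ignores the second component, which is
    therefore only required to lie in [C]; the joint minimum is attained at
    [(p z, c0)] for any [c0] in [C]. *)
Lemma enhanced_constrained (Zf : finHilbertType R) (C : set Zf) (z : Z)
    (c : Zf) : C !=set0 ->
  enhanced (Psic (EFin \o psi) C) (Bc B) ((z, c) : hprod Z Zf) =
  (eindicator R C c + (psi z - envelope_obj z (p z))%:E)%E.
Proof.
move=> [c0 Cc0]; rewrite /enhanced.
have obj (v : Z) (d : Zf) :
    (Psic (EFin \o psi) C ((v, d) : hprod Z Zf)
     + (2^-1 * `|Bc B (((z, c) : hprod Z Zf) - (v, d))| ^+ 2)%:E =
     (envelope_obj z v)%:E + eindicator R C d)%E.
  have -> : `|Bc B (((z, c) : hprod Z Zf) - (v, d))| ^+ 2 = `|B (z - v)| ^+ 2.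
    rewrite -!inner_norm; apply: etrans (addr0 _).
    by congr (_ + _); exact: inner0l.
  by rewrite /Psic /= addeAC.
rewrite (@emin_attained _ _ _ ((p z, c0) : hprod Z Zf)).
  rewrite obj /eindicator [in X in (_ - X)%E]mem_set// adde0 /Psic /=.
  by rewrite EFinB addeCA addeA.
case=> v d; rewrite !obj /eindicator mem_set// adde0.
by case: ifP => _; rewrite ?adde0 ?addey ?leey// lee_fin.
Qed.

End partial_envelope.

(** * The objective *)

(** The quadratic form of the operator is the curvature of the fidelity term
    minus that of [mu] times the penalty in the envelope. *)
Lemma psd_gap (R : realType) (X Y Z Zt : finHilbertType R)
    (A : 'Hom(X, Y)) (B : 'Hom(Z, Zt)) (L : 'Hom(X, Z)) (mu : R) :
  psd (adjoint A \o A - mu *: (adjoint L \o adjoint B \o B \o L))%VF ->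
  forall x, mu * `|B (L x)| ^+ 2 <= `|A x| ^+ 2.
Proof.
move=> [_ /[swap] x /(_ x)].
rewrite add_lfunE opp_lfunE scale_lfunE !comp_lfunE -scaleNr innerDl innerZl.
by rewrite !adjointPl !inner_norm mulNr subr_ge0.
Qed.

(** The objective is the indicator of [D @^-1` C] plus the finite function [h],
    whose convexity is the balance between the surplus of [1/2 |A x|^2] and the
    defect of [- mu m (L x)]. *)
Lemma Gamma0_enhanced (R : realType) (X Y Z Zt Zf : finHilbertType R)
    (C : set Zf) (psi : Z -> R) (A : 'Hom(X, Y)) (B : 'Hom(Z, Zt))
    (L : 'Hom(X, Z)) (D : 'Hom(X, Zf)) (mu : R) :
  C !=set0 -> closed C -> convex_set C -> C `&` range D !=set0 ->
  lower_semicontinuous (EFin \o psi) -> econvex (EFin \o psi) ->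
  coercive (EFin \o psi) -> 0 < mu ->
  (forall x, mu * `|B (L x)| ^+ 2 <= `|A x| ^+ 2) ->
  Gamma0 (fun x => (2^-1 * `|A x| ^+ 2)%:E +
    mu%:E * enhanced (Psic (EFin \o psi) C) (Bc B) (Lc L D x))%E.
Proof.
move=> C0 C_closed C_cvx [_ [/[swap] [[x0 _ <-] CDx0]]].
move=> psi_lsc psi_cvx psi_coer mu0 gap.
have [p pP] := envelope_attained B psi_lsc psi_coer.
pose h x := 2^-1 * `|A x| ^+ 2
  + mu * (psi (L x) + - envelope_obj psi B (L x) (p (L x))).
suff -> : (fun x => (2^-1 * `|A x| ^+ 2)%:E +
    mu%:E * enhanced (Psic (EFin \o psi) C) (Bc B) (Lc L D x))%E =
    (eindicator R (D @^-1` C) \+ (EFin \o h))%E.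
  apply: Gamma0D_fin.
  - apply: Gamma0_indicator.
    + by exists x0.
    + by apply: preimage_closed => // x _; exact: continuous_lfun.
    + move=> x y t /andP[t0 t1] Dx Dy; rewrite /= linearD !linearZ.
      pose t' : {i01 R} := Itv01 (ltW t0) (ltW t1).
      have := C_cvx (D x) (D y) t' (mem_set Dx) (mem_set Dy).
      by move/set_mem.
  - apply: (@lower_semicontinuousD _ _ (EFin \o (fun x => 2^-1 * `|A x| ^+ 2))
      (EFin \o (fun x => mu * (psi (L x)
        + - envelope_obj psi B (L x) (p (L x)))))) => //.
      apply: continuous_lower_semicontinuous.
      have -> : (fun x => 2^-1 * `|A x| ^+ 2) =
          (fun x => 2^-1 * `|A (x + 0)| ^+ 2) :> (X -> R).
        by apply/funext => x; rewrite addr0.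
      exact: continuous_half_sqr_norm_lfun.
    apply: lower_semicontinuousZ => //.
    apply: (@lower_semicontinuousD _ _ ((EFin \o psi) \o L)
      ((EFin \o (fun z => - envelope_obj psi B z (p z))) \o L)) => //;
    apply: lower_semicontinuous_comp => //; try exact: continuous_lfun.
    exact: opp_envelope_lsc.
  - move=> x y t t01; rewrite /= -!EFinM -EFinD lee_fin.
    have /andP[t0 t1] := t01.
    have := psi_cvx (L x) (L y) t t01.
    rewrite /= -!EFinM -EFinD lee_fin => hpsi.
    have henv := opp_envelope_weakly_convex pP (L x) (L y) t01.
    have lin_comb (K : finHilbertType R) (T : 'Hom(X, K)) :
        T (t *: x + (1 - t) *: y) = t *: T x + (1 - t) *: T y.
      by rewrite linearD !linearZ.
    have linB (K : finHilbertType R) (T : 'Hom(X, K)) : T (x - y) = T x - T y.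
      exact: linearB.
    have := gap (x - y); rewrite !linB => hgap.
    rewrite /h !lin_comb sqr_norm_convex_comb.
    (* With these products formed, the claim is linear in the monomials. *)
    have {}hpsi := ler_wpM2l (ltW mu0) hpsi.
    have {}henv := ler_wpM2l (ltW mu0) henv.
    have tt : 0 <= t * (1 - t) by rewrite mulr_ge0 ?subr_ge0 ?ltW.
    have {}hgap := ler_wpM2l tt hgap.
    lra.
apply/funext => x; rewrite /Lc (enhanced_constrained pP)// /h /=.
rewrite muleDr//; last by rewrite fin_num_adde_defl.
rewrite addeCA -EFinM -EFinD; congr (_ + _)%E.
rewrite /eindicator.
have -> : (x \in D @^-1` C) = (D x \in C) by apply/idP/idP => /set_mem/mem_set.
by case: ifP => _; rewrite ?mule0// gt0_muley ?lte_fin.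
Qed.

(** Expanding the square, changing [0] into [y] adds the continuous affine
    function [g], whose finiteness lets [F] take infinite values. *)
Lemma Gamma0_tilt (R : realType) (X Y : finHilbertType R) (A : 'Hom(X, Y))
    (F : X -> \bar R) (y : Y) :
  Gamma0 (fun x => (2^-1 * `|A x| ^+ 2)%:E + F x)%E ->
  Gamma0 (fun x => (2^-1 * `|y - A x| ^+ 2)%:E + F x)%E.
Proof.
move=> GF.
pose g x := 2^-1 * `|y| ^+ 2 - inner x (adjoint A y).
suff -> : (fun x => (2^-1 * `|y - A x| ^+ 2)%:E + F x)%E =
    ((fun x => (2^-1 * `|A x| ^+ 2)%:E + F x) \+ (EFin \o g))%E.
  apply: Gamma0D_fin => //.
    apply: continuous_lower_semicontinuous => x.
    by apply: cvgB; [exact: cvg_cst | exact: continuous_inner].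
  move=> u v t _; rewrite /= -!EFinM -EFinD lee_fin /g innerDl !innerZl.
  by rewrite le_eqVlt; apply/orP; left; apply/eqP; ring.
apply/funext => x /=; rewrite addeAC -EFinD; congr (_%:E + _)%E.
by rewrite /g -adjointP sqr_normB innerC; field.
Qed.

Theorem proposition1 (R : realType) (X Y Z Zt Zf : finHilbertType R)
    (C : set Zf) (Psi : Z -> \bar R)
    (A : 'Hom(X, Y)) (B : 'Hom(Z, Zt)) (L : 'Hom(X, Z)) (D : 'Hom(X, Zf))
    (mu : R) :
  C !=set0 -> closed C -> convex_set C ->
  Gamma0 Psi -> coercive Psi -> edom Psi = setT ->
  0 < mu -> C `&` range D !=set0 ->
  let PsiBcLc : X -> \bar R := enhanced (Psic Psi C) (Bc B) \o Lc L D in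
  let C1 := psd (adjoint A \o A
                 - mu *: (adjoint L \o adjoint B \o B \o L))%VF in
  let C2 := forall y : Y,
    Gamma0 (fun x => (2^-1 * `|y - A x| ^+ 2)%:E + mu%:E * PsiBcLc x)%E in
  let C3 :=
    Gamma0 (fun x => (2^-1 * `|A x| ^+ 2)%:E + mu%:E * PsiBcLc x)%E in
  (C1 -> C2) /\ (C2 <-> C3).
Proof.
move=> C0 C_closed C_cvx [[PsiNy _] Psi_lsc Psi_cvx] Psi_coer Psi_dom mu0 CD.
move=> PsiBcLc C1 C2 C3.
have C32 : C3 -> C2 by move=> c3 y; exact: Gamma0_tilt.
split; last first.
  split=> [/(_ 0)|//]; congr Gamma0; apply/funext => x.
  by rewrite sub0r normrN.
move=> /psd_gap gap; apply: C32; rewrite /C3 /PsiBcLc.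
have PsiE : Psi = EFin \o (fine \o Psi).
  apply/funext => z; rewrite /= fineK// fin_numE PsiNy /=.
  have : edom Psi z by rewrite Psi_dom.
  by rewrite /edom /= lt_neqAle => /andP[].
move: Psi_lsc Psi_cvx Psi_coer; rewrite PsiE => Psi_lsc Psi_cvx Psi_coer.
exact: Gamma0_enhanced.
Qed.
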